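(* Let $(M,\cdot,\tilde g,E)$ be a weak $\mathfrak{F}$-manifold with $L_E(\tilde g)=D\tilde g$, $L_E(\cdot)=k\,\cdot$, and let $T(u)=\frac{D+k}{2}u-\tilde g(\tilde\nabla_{\tilde g^*(u)}E)$. Let $g$ be the metric on $M$ defined by $g^*\tilde g=E\cdot$ (i.e. $g^*(\tilde g(X))=E\cdot X$), and let $R,\tilde R$ be the curvatures of $g,\tilde g$. Then for every $\alpha\in\mathcal{E}^1(M)$ and $X,Y\in\mathcal{X}(M)$, $$\begin{aligned}R_{E\cdot X,E\cdot Y}(\alpha)-\tilde R_{E\cdot X,E\cdot Y}(\alpha)&=\tilde\nabla_{E\cdot X}(\cdot)\big(T(\alpha)\cdot(E^\flat)^{-1},\,E^\flat\cdot Y^\flat\big)-\tilde\nabla_{E\cdot Y}(\cdot)\big(T(\alpha)\cdot(E^\flat)^{-1},\,E^\flat\cdot X^\flat\big)\\&\quad+\tilde\nabla_{E\cdot X}(T)(\alpha)\cdot Y^\flat-\tilde\nabla_{E\cdot Y}(T)(\alpha)\cdot X^\flat.\end{aligned}$$ In particular, $M$ (with the same data) is an $\mathfrak{F}$-manifold if and only if $$R_{E\cdot X,E\cdot Y}(\alpha)-\tilde R_{E\cdot X,E\cdot Y}(\alpha)=\tilde\nabla_{E\cdot X}(T)(\alpha)\cdot Y^\flat-\tilde\nabla_{E\cdot Y}(T)(\alpha)\cdot X^\flat$$ for every $\alpha\in\mathcal{E}^1(M)$ and $X,Y\in\mathcal{X}(M)$.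
   Context: Notation. $\mathcal{X}(M)$, $\mathcal{E}^1(M)$: smooth vector fields and $1$-forms on the smooth manifold $M$. ''Metric'' means pseudo-Riemannian metric. For a metric $g$, $g^*$ is the induced metric on $T^*M$; also $g(X)=g(X,\cdot)$ and $g^*\alpha$ is the vector field dual to the $1$-form $\alpha$. $\nabla$ ($\tilde\nabla$) is the Levi-Civita connection of $g$ ($\tilde g$), also on $T^*M$; curvatures act on $1$-forms by $R_{X,Y}=\nabla_X\nabla_Y-\nabla_Y\nabla_X-\nabla_{[X,Y]}$, similarly $\tilde R$. For a vector field $X$, $X^\flat:=\tilde g(X)$. The multiplication $\cdot$ on $TM$ induces, via $\tilde g$, a multiplication on $T^*M$, also written $\cdot$: $X^\flat\cdot Y^\flat=(X\cdot Y)^\flat$; $(E^\flat)^{-1}=(E^{-1})^\flat$ is the inverse of $E^\flat$. $\tilde\nabla_X(\cdot)(\alpha,\beta)=\tilde\nabla_X(\alpha\cdot\beta)-\tilde\nabla_X(\alpha)\cdot\beta-\alpha\cdot\tilde\nabla_X(\beta)$ for $1$-forms (similarly for vector fields), and $\tilde\nabla_X(T)(\alpha)=\tilde\nabla_X(T(\alpha))-T(\tilde\nabla_X\alpha)$. Weak $\mathfrak{F}$-manifold: a manifold $M$ with a multiplication $\cdot$ on $TM$ (a bundle map, bilinear on fibres), a vector field $E$ (the Euler field) and a metric $\tilde g$ such that (1) $\cdot$ is associative, commutative, with unity $e$; (2) $E$ has an inverse $E^{-1}$ with respect to $\cdot$, satisfies $L_E(\cdot)=k\,\cdot$ (i.e.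 $[E,X\cdot Y]-[E,X]\cdot Y-X\cdot[E,Y]=kX\cdot Y$) and $L_E(\tilde g)=D\tilde g$ for constants $k,D$, and the operator $T(u):=\frac{D+k}{2}u-\tilde g(\tilde\nabla_{\tilde g^*(u)}E)$ is an automorphism of $T^*M$; (3) $\tilde g(X\cdot Y,Z)=\tilde g(X,Y\cdot Z)$ for all $X,Y,Z\in\mathcal{X}(M)$; (4) $\tilde\nabla(\cdot)(X,Y,Z,E)=\tilde\nabla(\cdot)(E,X,Y,Z)$ for all $X,Y,Z\in\mathcal{X}(M)$, where $\tilde\nabla(\cdot)(X,Y,Z,V):=\tilde g(\tilde\nabla_X(\cdot)(Y,Z),V)$. An $\mathfrak{F}$-manifold satisfies (1), (2), (3) and, instead of (4), the stronger condition that the $(4,0)$-tensor $\tilde\nabla(\cdot)$ is symmetric in all its arguments. *)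

(* Defs.v *)
From HB Require Import structures.
From mathcomp Require Import all_boot all_order all_algebra all_fingroup.
From mathcomp Require Import all_classical all_reals all_analysis.
Set Implicit Arguments.
Unset Strict Implicit.
Unset Printing Implicit Defensive.
Import Order.TTheory GRing.Theory Num.Theory.
Import numFieldNormedType.Exports.
Local Open Scope classical_set_scope.
Local Open Scope ring_scope.

Section SmoothEuclidean.
Variables (R : realType) (n : nat).
Implicit Types (U : set 'rV[R]_n) (f g : 'rV[R]_n -> R).

(* Class C^k on U by iterated partial derivatives.  Only used for open U, where
   it does not depend on the values of f outside U. *)
Fixpoint class_C (k : nat) U f : Prop :=
  (forall x, U x -> {for x, continuous f}) /\
  if k is k'.+1 then
    forall i : 'I_n, (forall x, U x -> derivable f x (delta_mx 0 i)) /\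
                     class_C k' U (fun x => 'D_(delta_mx 0 i) f x)
  else True.

Definition smooth_on U f : Prop := forall k, class_C k U f.

Lemma class_C_ext k U f g : open U -> (forall x, U x -> f x = g x) ->
  class_C k U f -> class_C k U g.
Proof.
move=> oU fg.
have nfg (f' g' : 'rV[R]_n -> R) x : (forall y, U y -> f' y = g' y) -> U x ->
    \forall y \near x, f' y = g' y.
  move=> fg' Ux; near=> y; apply: fg'; by near: y; exact: open_nbhs_nbhs.
have ccg (f' g' : 'rV[R]_n -> R) x : (forall y, U y -> f' y = g' y) -> U x ->
    {for x, continuous f'} -> {for x, continuous g'}.
  move=> fg' Ux; rewrite /prop_for /continuous_at (fg' x Ux) => h.
  by apply: cvg_trans h; exact: near_eq_cvg (nfg _ _ x fg' Ux).
elim: k f g fg => [|k IH] f g fg /=.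
  case=> cf _; split=> // x Ux; exact: ccg (cf x Ux).
case=> cf df; split=> [x Ux|i]; first exact: ccg (cf x Ux).
case: (df i) => d1 d2.
split=> [x Ux|].
  exact: (near_eq_derivable (nfg _ _ x fg Ux) (d1 x Ux)).
apply: IH d2 => x Ux; apply: near_eq_derive; exact: nfg.
Unshelve. all: by end_near. Qed.

Lemma class_CS k U f : class_C k.+1 U f -> class_C k U f.
Proof.
elim: k f => [|k IH] f; first by move=> [cf _]; exact: (conj cf I).
move=> [cf df]; split=> [|i]; first exact: cf.
by have [d1 d2] := df i; split; [exact: d1|exact: IH d2].
Qed.

Lemma class_C_cst k U (c : R) : class_C k U (fun=> c).
Proof.
elim: k c => [|k IH] c; (split; first by move=> x _; apply: cst_continuous) => // i.
split=> [x _|]; first exact: derivable_cst.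
have -> : (fun x : 'rV[R]_n => 'D_(delta_mx 0 i) (fun=> c : R) x) = fun=> 0.
  by apply/funext => x; rewrite derive_cst.
exact: IH.
Qed.

Lemma class_CB k U f g : open U -> class_C k U f -> class_C k U g ->
  class_C k U (f - g).
Proof.
move=> oU; elim: k f g => [|k IH] f g [cf df] [cg dg];
  (split; first by move=> x Ux; apply: continuousB; [exact: cf|exact: cg]) => // i.
have [[f1 f2] [g1 g2]] := (df i, dg i).
split=> [x Ux|]; first by apply: derivableB; [exact: f1|exact: g1].
apply: (class_C_ext oU _ (IH _ _ f2 g2)) => x Ux.
by rewrite deriveB //; [exact: f1|exact: g1].
Qed.

Lemma class_CD k U f g : open U -> class_C k U f -> class_C k U g ->
  class_C k U (f + g).
Proof.
move=> oU hf hg; have -> : f + g = f - ((fun=> 0) - g).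
  by apply/funext => x; rewrite !fctE sub0r opprK.
by do 2! [apply: class_CB => //]; exact: class_C_cst.
Qed.

Lemma class_CM k U f g : open U -> class_C k U f -> class_C k U g ->
  class_C k U (f * g).
Proof.
move=> oU; elim: k f g => [|k IH] f g hf hg; case: (hf) (hg) => [cf df] [cg dg];
  (split; first by move=> x Ux; apply: continuousM; [exact: cf|exact: cg]) => // i.
have [[f1 f2] [g1 g2]] := (df i, dg i).
split=> [x Ux|]; first by apply: derivableM; [exact: f1|exact: g1].
have h := class_CD oU (IH _ _ (class_CS hf) g2) (IH _ _ (class_CS hg) f2).
apply: (class_C_ext oU _ h) => x Ux.
by rewrite deriveM //; [exact: f1|exact: g1].
Qed.

End SmoothEuclidean.

Record chart (R : realType) (n : nat) (M : topologicalType) := Chart {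
  chart_dom : set M;
  chart_map : M -> 'rV[R]_n;
  chart_inv : 'rV[R]_n -> M;
  chart_dom_open : open chart_dom;
  chart_im_open : open (chart_map @` chart_dom);
  chart_mapK : forall p, chart_dom p -> chart_inv (chart_map p) = p;
  chart_map_continuous : forall p, chart_dom p -> {for p, continuous chart_map};
  chart_inv_continuous :
    forall x, (chart_map @` chart_dom) x -> {for x, continuous chart_inv} }.

Definition chart_compatible (R : realType) (n : nat) (M : topologicalType)
    (phi psi : chart R n M) : Prop :=
  forall i : 'I_n,
    smooth_on (chart_map phi @` (chart_dom phi `&` chart_dom psi))
              (fun x => chart_map psi (chart_inv phi x) 0 i).

Record manifold (R : realType) (n : nat) := Manifold {
  manifold_sort :> topologicalType;
  manifold_hausdorff : hausdorff_space manifold_sort;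
  manifold_second_countable : @second_countable manifold_sort;
  atlas : set (chart R n manifold_sort);
  atlas_cover : forall p, exists2 phi, atlas phi & chart_dom phi p;
  atlas_compatible :
    forall phi psi, atlas phi -> atlas psi -> chart_compatible phi psi }.

Section Functions.
Variables (R : realType) (n : nat) (M : manifold R n).

Definition smooth (f : M -> R) : Prop :=
  forall phi, atlas phi ->
    smooth_on (chart_map phi @` chart_dom phi) (f \o chart_inv phi).

Definition smooth_pred : {pred M -> R} := [pred f | `[< smooth f >]].

Lemma smooth_pred_subring : subring_closed smooth_pred.
Proof.
split.
- apply/asboolP => phi _ k; exact: class_C_cst.
- move=> f g /asboolP hf /asboolP hg; apply/asboolP => phi aphi k.
  apply: class_CB; [exact: chart_im_open|exact: hf|exact: hg].
- move=> f g /asboolP hf /asboolP hg; apply/asboolP => phi aphi k.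
  apply: class_CM; [exact: chart_im_open|exact: hf|exact: hg].
Qed.

HB.instance Definition _ :=
  GRing.isSubringClosed.Build (M -> R) smooth_pred smooth_pred_subring.

(* The ring C^oo(M). *)
Record smooth_fun := SmoothFun {
  smooth_val :> M -> R;
  smooth_valP : smooth_val \in smooth_pred }.
HB.instance Definition _ := [isSub for smooth_val].
HB.instance Definition _ := [Choice of smooth_fun by <:].
HB.instance Definition _ := GRing.SubChoice_isSubComPzRing.Build
  (M -> R) smooth_pred smooth_fun (subringClosedP smooth_pred).

Lemma cst_smooth (c : R) : (fun=> c) \in smooth_pred.
Proof. apply/asboolP => phi _ k; exact: class_C_cst. Qed.

Definition smooth_cst (c : R) : smooth_fun := SmoothFun (cst_smooth c).

End Functions.

Section Fields.
Variables (R : realType) (n : nat) (M : manifold R n).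
Local Notation C := (smooth_fun M).

(* Smooth vector fields are identified with the R-linear derivations of C^oo(M). *)
Definition derivation (X : C -> C) : Prop :=
  [/\ forall f h, X (f + h) = X f + X h,
      forall (c : R) f, X (smooth_cst M c * f) = smooth_cst M c * X f
    & forall f h, X (f * h) = f * X h + X f * h].

Definition derivation_pred : {pred C -> C^o} := [pred X | `[< derivation X >]].

Lemma derivation_pred_submod : submod_closed derivation_pred.
Proof.
split.
  apply/asboolP; split.
  - by move=> f h; change (0 = 0 + 0 :> C); rewrite addr0.
  - by move=> c f; change (0 = smooth_cst M c * 0); rewrite mulr0.
  - by move=> f h; change (0 = f * 0 + 0 * h); rewrite mulr0 mul0r addr0.
move=> a X Y /asboolP[XD XZ XM] /asboolP[YD YZ YM]; apply/asboolP.
split=> [f h|c f|f h].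
- change (a * X (f + h) + Y (f + h) = (a * X f + Y f) + (a * X h + Y h) :> C).
  by rewrite XD YD mulrDr addrACA.
- change (a * X (smooth_cst M c * f) + Y (smooth_cst M c * f) =
          smooth_cst M c * (a * X f + Y f) :> C).
  by rewrite XZ YZ mulrDr mulrCA.
- change (a * X (f * h) + Y (f * h) =
          f * (a * X h + Y h) + (a * X f + Y f) * h :> C).
  by rewrite XM YM !mulrDr mulrDl addrACA mulrCA !mulrA.
Qed.

HB.instance Definition _ :=
  GRing.isSubmodClosed.Build C (C -> C^o) derivation_pred
    derivation_pred_submod.

Record vector_field := VectorField {
  vector_val :> C -> C^o;
  vector_valP : vector_val \in derivation_pred }.
HB.instance Definition _ := [isSub for vector_val].
HB.instance Definition _ := [Choice of vector_field by <:].
HB.instance Definition _ := [SubChoice_isSubLmodule of vector_field by <:].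

Lemma bracket_derivation (X Y : vector_field) :
  (fun f : C => X (Y f) - Y (X f) : C^o) \in derivation_pred.
Proof.
have /asboolP[XD XZ XM] := vector_valP X.
have /asboolP[YD YZ YM] := vector_valP Y.
apply/asboolP; split.
- by move=> f h; rewrite XD YD XD YD opprD addrACA.
- by move=> c f; rewrite XZ YZ XZ YZ mulrBr.
- have ac (a b c d a' d' : C) :
      a + b + (c + d) - (a' + c + (b + d')) = a - a' + (d - d').
    rewrite (AC (2*2) (1*4*(2*3)))/= [a' + c + _](AC (2*2) (1*4*(3*2)))/=.
    by rewrite opprD [LHS]addrACA subrr addr0 opprD addrACA.
  by move=> f h; rewrite XM YM XD YD !XM !YM mulrBr mulrBl ac.
Qed.

Definition bracket (X Y : vector_field) : vector_field :=
  VectorField (bracket_derivation X Y).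

(* Smooth 1-forms are identified with the C^oo(M)-linear maps X(M) -> C^oo(M). *)
Definition form_linear (a : vector_field -> C) : Prop :=
  forall (f : C) X Y, a (f *: X + Y) = f * a X + a Y.

Definition form_pred : {pred vector_field -> C^o} :=
  [pred a | `[< form_linear a >]].

Lemma form_pred_submod : submod_closed form_pred.
Proof.
split.
  by apply/asboolP => f X Y; change (0 = f * 0 + 0 :> C); rewrite mulr0 addr0.
move=> c a b /asboolP ha /asboolP hb; apply/asboolP => f X Y.
change (c * a (f *: X + Y) + b (f *: X + Y) =
        f * (c * a X + b X) + (c * a Y + b Y) :> C).
by rewrite ha hb !mulrDr addrACA mulrCA.
Qed.

HB.instance Definition _ :=
  GRing.isSubmodClosed.Build C (vector_field -> C^o) form_pred form_pred_submod.

Record one_form := OneForm {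
  form_val :> vector_field -> C^o;
  form_valP : form_val \in form_pred }.
HB.instance Definition _ := [isSub for form_val].
HB.instance Definition _ := [Choice of one_form by <:].
HB.instance Definition _ := [SubChoice_isSubLmodule of one_form by <:].

Lemma differential_linear (f : C) :
  (fun X : vector_field => X f) \in form_pred.
Proof. by apply/asboolP. Qed.

Definition differential (f : C) : one_form := OneForm (differential_linear f).

(* Tensor fields are identified with C^oo(M)-multilinear maps on sections.
   Nondegeneracy is the existence of the inverse g^* of the musical map
   X |-> g(X, .), i.e. g is an isomorphism TM -> T^*M.  The signature is
   arbitrary. *)
Record metric := Metric {
  flat :> vector_field -> one_form;
  sharp : one_form -> vector_field;
  flatC : forall X Y, flat X Y = flat Y X;
  flatK : cancel flat sharp;
  sharpK : cancel sharp flat }.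

Lemma metric_nondegenerate (g : metric) (X : vector_field) (p : M) :
  (forall Y : vector_field, smooth_val (g X Y) p = 0) ->
  forall f : C, smooth_val (X f) p = 0.
Proof.
move=> gX f; rewrite -(gX (sharp g (differential f))).
by rewrite flatC sharpK.
Qed.

(* A bundle map TM x TM -> TM, bilinear on fibres. *)
Record multiplication := Multiplication {
  fmul :> vector_field -> vector_field -> vector_field;
  fmul_linearl : forall (f : C) X Y Z,
    fmul (f *: X + Y) Z = f *: fmul X Z + fmul Y Z;
  fmul_linearr : forall (f : C) X Y Z,
    fmul X (f *: Y + Z) = f *: fmul X Y + fmul X Z }.

Record connection := Connection {
  nabla :> vector_field -> vector_field -> vector_field;
  nabla_linear : forall (f : C) X Y Z,
    nabla (f *: X + Y) Z = f *: nabla X Z + nabla Y Z;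
  nablaD : forall X Y Z, nabla X (Y + Z) = nabla X Y + nabla X Z;
  nabla_leibniz : forall (f : C) X Y,
    nabla X (f *: Y) = (X f : C) *: Y + f *: nabla X Y }.

Record levi_civita (g : metric) := LeviCivita {
  lc :> connection;
  lc_torsion_free : forall X Y, lc X Y - lc Y X = bracket X Y;
  lc_metric : forall X Y Z : vector_field,
    X (g Y Z) = g (lc X Y) Z + g Y (lc X Z) }.

Lemma nabla_form_linear (nb : connection) (X : vector_field) (a : one_form) :
  (fun Y : vector_field => X (a Y) - a (nb X Y)) \in form_pred.
Proof.
have /asboolP[XD _ XM] := vector_valP X.
have /asboolP al := form_valP a.
have aD Y Z : a (Y + Z) = a Y + a Z.
  by have := al 1 Y Z; rewrite scale1r mul1r.
have aZ f Y : a (f *: Y) = f * a Y :> C.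
  have a0 : a 0 = 0 :> C by apply: (addrI (a 0 : C)); rewrite addr0 -aD addr0.
  by have := al f Y 0; rewrite addr0 a0 addr0.
apply/asboolP => f Y Z; rewrite nablaD nabla_leibniz !aD !aZ XD XM.
have ac (p q r s t : C) : p + q + r - (q + s + t) = (p - s) + (r - t).
  rewrite [p + q]addrC -[q + p + r]addrA -[q + s + t]addrA.
  by rewrite opprD [LHS]addrACA subrr add0r opprD addrACA.
by rewrite ac mulrBr.
Qed.

(* The induced connection on T^*M. *)
Definition nabla_form (nb : connection) (X : vector_field) (a : one_form) :
    one_form :=
  OneForm (nabla_form_linear nb X a).

Definition curvature (nb : connection) (X Y : vector_field) (a : one_form) :
    one_form :=
  nabla_form nb X (nabla_form nb Y a) - nabla_form nb Y (nabla_form nb X a)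
  - nabla_form nb (bracket X Y) a.

End Fields.

Record F_data (R : realType) (n : nat) (M : manifold R n) := FData {
  dot : multiplication M;
  unity : vector_field M;
  euler : vector_field M;
  euler_inv : vector_field M;
  tmet : metric M }.

Section FManifold.
Variables (R : realType) (n : nat) (M : manifold R n) (S : F_data M).
Variables (tnb : levi_civita (tmet S)) (k D : R).
Local Notation vf := (vector_field M).
Local Notation form := (one_form M).
Local Notation cst := (smooth_cst M).
Local Notation gt := (tmet S).
Local Notation E := (euler S).
Local Notation "X ** Y" := (dot S X Y) (at level 40, left associativity).

Definition dot_form (a b : form) : form := gt (sharp gt a ** sharp gt b).

Definition nabla_dot (X Y Z : vf) : vf :=
  tnb X (Y ** Z) - tnb X Y ** Z - Y ** tnb X Z.

Definition nabla_dot_form (X : vf) (a b : form) : form :=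
  nabla_form tnb X (dot_form a b) - dot_form (nabla_form tnb X a) b
  - dot_form a (nabla_form tnb X b).

Definition nabla_dot4 (X Y Z V : vf) : smooth_fun M := gt (nabla_dot X Y Z) V.

Definition T_op (u : form) : form :=
  cst ((D + k) / 2) *: u - gt (tnb (sharp gt u) E).

Definition nabla_T (X : vf) (a : form) : form :=
  nabla_form tnb X (T_op a) - T_op (nabla_form tnb X a).

Definition assoc_comm_unital : Prop :=
  [/\ forall X Y Z, X ** (Y ** Z) = (X ** Y) ** Z,
      forall X Y, X ** Y = Y ** X
    & forall X, unity S ** X = X].

(* T is C^oo(M)-linear by construction, so that it is a bundle automorphism of
   T^*M iff it is bijective on 1-forms. *)
Definition euler_axioms : Prop :=
  [/\ E ** euler_inv S = unity S,
      forall X Y,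
        bracket E (X ** Y) - bracket E X ** Y - X ** bracket E Y =
        cst k *: (X ** Y),
      forall X Y,
        E (gt X Y) - gt (bracket E X) Y - gt X (bracket E Y) = cst D * gt X Y
    & bijective T_op].

Definition dot_invariant : Prop :=
  forall X Y Z, gt (X ** Y) Z = gt X (Y ** Z).

Definition weak_F_manifold : Prop :=
  [/\ assoc_comm_unital, euler_axioms, dot_invariant
    & forall X Y Z, nabla_dot4 X Y Z E = nabla_dot4 E X Y Z].

Definition symmetric4 (t : vf -> vf -> vf -> vf -> smooth_fun M) : Prop :=
  forall (s : 'S_4) (v : 'I_4 -> vf),
    let t' (w : 'I_4 -> vf) :=
      t (w ord0) (w (inord 1)) (w (inord 2)) (w ord_max) in
    t' (v \o s) = t' v.

Definition F_manifold : Prop :=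
  [/\ assoc_comm_unital, euler_axioms, dot_invariant & symmetric4 nabla_dot4].

End FManifold.

(* Main.v *)
From HB Require Import structures.
Require Import Defs.
From mathcomp Require Import all_boot all_order all_algebra all_fingroup ring.
From mathcomp Require Import all_classical all_reals all_analysis.
Set Implicit Arguments.
Unset Strict Implicit.
Unset Printing Implicit Defensive.
Import GRing.Theory Num.Theory.
Local Open Scope ring_scope.

(** The multiplication makes the module of vector fields a commutative ring
    [A], and the metric [gt] (g tilde) identifies 1-forms with elements of [A].
    Both curvatures then become expressions in [A] built from the operator
    nabla_x y of [gt], and the theorem splits into identities valid in any
    commutative ring with a biadditive nabla, and a dictionary.

    Write P_x(y, z) for the derivative of the product along x.
    - The weak symmetry axiom, once combined with the symmetry of
      gt(P_x(y, z), v) in y, z, v, reads P_x(E, y) = P_E(x, y)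
      ([nab_mul_euler]); the axiom on the Lie derivative of the product
      expresses nabla_(x y) E through P_E, nabla_x E and nabla_y E
      ([nab_eulerM]); differentiating associativity makes every P_x a
      symmetric 2-cocycle ([nab_mul_cocycle]).
    - The Levi-Civita connection of [g], transported to 1-forms and read in
      [A], is D_(E x) w = nabla_(E x) w + T(w) x.  By uniqueness of the
      Levi-Civita connection this amounts to two checks, on torsion
      ([dual_torsion]) and on the metric ([dual_metric]), which follow from
      the three facts above and, for the metric, from the conformal Killing
      equation for E.
    - The curvature of a connection nabla + L differs from that of nabla by the
      antisymmetrised derivative of L and a commutator.  With
      L_(E x) w = T(w) x the derivative gives the terms in nabla T, together
      with P_(E x)(T w, y) antisymmetrised; the commutator adds terms in P_E
      only ([twist_commutator]).  The cocycle identity shows that these P terms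
      add up to P_(E x)(T(w) E^-1, E y) antisymmetrised ([nab_mul_shift]),
      whence [dual_curvature].

    For the equivalence, T is onto and E is invertible, so T(a) E^-1, E x and
    E y are arbitrary elements of [A]: the P terms of the curvature formula
    vanish for all arguments if and only if P_x(u, y) = P_y(u, x).  As
    gt(P_x(y, z), v) is always symmetric in its last three arguments, this is
    total symmetry. *)

(** * Commutative rings with a connection *)

Section ConnectionOnRing.
Variables (A : comPzRingType) (nab : A -> A -> A).
Implicit Types (u v w x y z : A).

(** The derivative of the product along [x]. *)
Definition nab_mul x y z := nab x (y * z) - nab x y * z - y * nab x z.

Lemma nabM x y z : nab x (y * z) = nab_mul x y z + nab x y * z + y * nab x z.
Proof. rewrite /nab_mul; ring. Qed.

Lemma nab_mulC x y z : nab_mul x y z = nab_mul x z y.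
Proof. rewrite /nab_mul [y * z]mulrC; ring. Qed.

(** Associativity differentiated along [w]: the product's derivative is a
    Hochschild 2-cocycle. *)
Lemma nab_mul_cocycle w x y z :
  nab_mul w (x * y) z + nab_mul w x y * z =
  nab_mul w x (y * z) + x * nab_mul w y z.
Proof. rewrite /nab_mul mulrA; ring. Qed.

Hypothesis nabDl : forall x y z, nab (x + y) z = nab x z + nab y z.
Hypothesis nabDr : forall x y z, nab x (y + z) = nab x y + nab x z.

(* The constants (D + k) / 2 and k enter as the multiples [c] and [k] of the
   unit; [lieM] is L_E(.) = k . written with a torsion-free connection. *)
Variables (E Einv c k : A).
Hypothesis EEinv : E * Einv = 1.
Hypothesis lieM : forall x y,
  nab_mul E x y - nab (x * y) E + nab x E * y + x * nab y E = k * (x * y).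
Hypothesis nab_mul_euler : forall x y, nab_mul x E y = nab_mul E x y.

(** By the cocycle identity,
    P_E(E x, y) + P_E(E, x) y = P_E(E, x y) + E P_E(x, y), whose right-hand
    side is symmetric in [x] and [y]; solved for one term so that it can be used
    to rewrite. *)
Lemma nab_mul_euler_exchange x y :
  nab_mul E (E * x) y =
  nab_mul E (E * y) x + nab_mul E E y * x - nab_mul E E x * y.
Proof.
apply/(addIr (nab_mul E E x * y)); rewrite /= subrK.
by rewrite !nab_mul_cocycle [y * x]mulrC [nab_mul E y x]nab_mulC.
Qed.

Lemma nab_eulerM x y :
  nab (x * y) E = nab_mul E x y + nab x E * y + x * nab y E - k * (x * y).
Proof. rewrite -(lieM x y); ring. Qed.

(** The operator T on vector fields. *)
Definition twist x := c * x - nab x E.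

Lemma twistD x y : twist (x + y) = twist x + twist y.
Proof. rewrite /twist nabDl; ring. Qed.

(** The Levi-Civita connection of [g] conjugated by multiplication by [E], that
    is, acting on 1-forms identified with vector fields by [gt] instead of [g];
    [dual_nabE] is its more transparent form. *)
Definition dual_nab x w := nab x w + twist w * (Einv * x).

Lemma Einv_mulEl x : Einv * (E * x) = x.
Proof. by rewrite mulrA [Einv * E]mulrC EEinv mul1r. Qed.

Lemma E_mulEinvl x : E * (Einv * x) = x.
Proof. by rewrite mulrA EEinv mul1r. Qed.

Lemma dual_nabE x w : dual_nab (E * x) w = nab (E * x) w + twist w * x.
Proof. by rewrite /dual_nab Einv_mulEl. Qed.

(** The conjugate E D_x (E^-1 y) of [dual_nab] is torsion-free. *)
Lemma dual_torsion x y :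
  E * (dual_nab (E * x) y - dual_nab (E * y) x) =
  nab (E * x) (E * y) - nab (E * y) (E * x).
Proof.
rewrite !dual_nabE [nab (E * x) (E * y)]nabM [nab (E * y) (E * x)]nabM.
rewrite /twist !nab_mul_euler !nab_eulerM.
rewrite (nab_mul_euler_exchange x y); ring.
Qed.

(** The commutator term of the curvature of [dual_nab], minus the part that
    comes from the derivative along a bracket. *)
Lemma twist_commutator v x y :
  twist (v * y) * x - twist (v * x) * y
    - v * (twist y * x - twist x * y) =
  nab_mul E v x * y - nab_mul E v y * x.
Proof. rewrite /twist !nab_eulerM; ring. Qed.

(** Moving [E] from the first argument of the product's derivative to the second
    costs, by the cocycle identity and [nab_mul_euler], only terms in P_E; after
    antisymmetrisation these no longer involve E^-1. *)
Lemma nab_mul_shift v x y :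
  nab_mul (E * x) (v * Einv) (E * y) - nab_mul (E * y) (v * Einv) (E * x) =
  nab_mul (E * x) v y - nab_mul (E * y) v x
    + nab_mul E v x * y - nab_mul E v y * x.
Proof.
set u := v * Einv.
have vE : v = u * E by rewrite /u -mulrA [Einv * E]mulrC EEinv mulr1.
have shift z w : nab_mul z u (E * w) =
    nab_mul z v w + nab_mul E z u * w - u * nab_mul E z w.
  rewrite -!nab_mul_euler [nab_mul z E u]nab_mulC vE.
  by rewrite nab_mul_cocycle addrK.
have shiftE w : nab_mul E v w =
    nab_mul E u (E * w) + u * nab_mul E E w - nab_mul E E u * w.
  by rewrite vE -nab_mul_cocycle [nab_mul E E u]nab_mulC addrK.
rewrite !shift !(shiftE x) !(shiftE y).
rewrite [nab_mul E (E * x) u]nab_mulC [nab_mul E (E * y) u]nab_mulC.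
rewrite (nab_mul_euler_exchange x y); ring.
Qed.

Definition nab_twist x w := nab x (twist w) - twist (nab x w).

(** [E * b] is the bracket of [E * x] and [E * y]; writing it with [dual_nab]
    through [dual_torsion] is what makes the derivatives of [x] and [y]
    cancel. *)
Lemma dual_curvature x y w b :
  E * b = nab (E * x) (E * y) - nab (E * y) (E * x) ->
  let curv D :=
    D (E * x) (D (E * y) w) - D (E * y) (D (E * x) w) - D (E * b) w in
  curv dual_nab - curv nab =
  nab_mul (E * x) (twist w * Einv) (E * y)
    - nab_mul (E * y) (twist w * Einv) (E * x)
    + nab_twist (E * x) w * y - nab_twist (E * y) w * x.
Proof.
rewrite -dual_torsion => bE /=.
have {bE} bE : b = dual_nab (E * x) y - dual_nab (E * y) x.
  by rewrite -[LHS]Einv_mulEl bE Einv_mulEl.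
(* [b] is expanded in twist w * b but not in nab (E * b) w, which occurs in
   both curvatures and cancels. *)
rewrite nab_mul_shift !dual_nabE !nabDr !twistD !nabM {2}bE.
rewrite !dual_nabE /nab_twist.
rewrite -[_ + nab_mul E _ x * y - _]addrA -twist_commutator; ring.
Qed.

Variables (C : zmodType) (B : A -> A -> C).
Hypothesis BDl : forall x y z, B (x + y) z = B x z + B y z.
Hypothesis BDr : forall x y z, B x (y + z) = B x y + B x z.
Hypothesis BM : forall x y z, B (x * y) z = B x (y * z).
(* The conformal Killing equation of [E], with D = c + c - k. *)
Hypothesis killing : forall x y,
  B (nab x E) y + B x (nab y E) = B ((c + c - k) * x) y.

(** The Killing equation trades the adjoint of nabla E for nabla E itself. *)
Lemma twist_adjoint x y : B x (twist y) = B (nab x E - (c - k) * x) y.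
Proof.
have BBl u v z : B (u - v) z = B u z - B v z.
  by apply/(addIr (B v z)); rewrite /= -BDl !subrK.
have BBr u v z : B u (v - z) = B u v - B u z.
  by apply/(addIr (B u z)); rewrite /= -BDr !subrK.
have kil : B x (nab y E) = B ((c + c - k) * x) y - B (nab x E) y.
  by rewrite -killing addrC addKr.
by rewrite /twist BBr kil -BM -!BBl; congr (B _ y); ring.
Qed.

(** Both sides compute the derivative of B (E * w) z along [x]: [dual_nab] is
    metric for the form B (E * w) z as soon as [nab] is metric for [B]. *)
Lemma dual_metric x w z :
  B (nab x (E * w)) z + B (E * w) (nab x z) =
  B (E * dual_nab x w) z + B (E * w) (dual_nab x z).
Proof.
rewrite -[x]E_mulEinvl; move: (Einv * x) => y; rewrite !dual_nabE BDr.
rewrite [twist z * y]mulrC -BM twist_adjoint addrCA [LHS]addrC; congr (_ + _).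
rewrite -BDl; congr (B _ z).
rewrite [E * w * y]mulrAC nabM nab_mul_euler !nab_eulerM /twist; ring.
Qed.
End ConnectionOnRing.

(** * Forms, metrics and the Levi-Civita connection *)

Section Fields.
Variables (R : realType) (n : nat) (M : manifold R n).
Local Notation C := (smooth_fun M).
Local Notation vf := (vector_field M).
Local Notation form := (one_form M).
Local Notation cst := (smooth_cst M).

Lemma smooth_cstD (a b : R) : cst (a + b) = cst a + cst b.
Proof. exact/val_inj. Qed.

Lemma smooth_cst1 : cst 1 = 1.
Proof. exact/val_inj. Qed.

Lemma smooth_double_eq0 (f : C) : f + f = 0 -> f = 0.
Proof.
move=> ff0; rewrite -[f]mul1r -smooth_cst1 [X in cst X]splitr.
by rewrite smooth_cstD mulrDl -mulrDr ff0 mulr0.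
Qed.

Lemma one_form_ext (a b : form) : (forall X, a X = b X) -> a = b.
Proof. by move=> ab; apply/val_inj/funext. Qed.

Lemma formZ (a : form) (f : C) (X Y : vf) : a (f *: X + Y) = f * a X + a Y :> C.
Proof. by have /asboolP := form_valP a. Qed.

Lemma formD (a : form) (X Y : vf) : a (X + Y) = a X + a Y :> C.
Proof. by rewrite -[X]scale1r formZ mul1r scale1r. Qed.

Lemma metricDr (g : metric M) X Y Z : g X (Y + Z) = g X Y + g X Z :> C.
Proof. exact: formD. Qed.

Lemma metricDl (g : metric M) X Y Z : g (X + Y) Z = g X Z + g Y Z :> C.
Proof. by rewrite !(flatC _ _ Z) formD. Qed.

Lemma metricZl (g : metric M) f X Y : g (f *: X) Y = f * g X Y :> C.
Proof.
have g0 : g Y 0 = 0 :> C by apply: (addrI (g Y 0 : C)); rewrite -formD !addr0.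
by rewrite !(flatC _ _ Y) -[f *: X]addr0 formZ g0 addr0.
Qed.

Lemma flatD (g : metric M) X Y : g (X + Y) = g X + g Y.
Proof. by apply: one_form_ext => Z; rewrite metricDl. Qed.

Lemma flatB (g : metric M) X Y : g (X - Y) = g X - g Y.
Proof. by apply: (addIr (g Y)); rewrite -flatD !subrK. Qed.

Lemma flatZ (g : metric M) f X : g (f *: X) = f *: g X.
Proof. by apply: one_form_ext => Z; rewrite metricZl. Qed.

Lemma metricNl (g : metric M) X Y : g (- X) Y = - (g X Y : C).
Proof. by rewrite -scaleN1r metricZl mulN1r. Qed.

Lemma metricNr (g : metric M) X Y : g X (- Y) = - (g X Y : C).
Proof. by rewrite !(flatC _ X) metricNl. Qed.

Lemma metric_inj (g : metric M) X Y : (forall Z, g X Z = g Y Z) -> X = Y.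
Proof. by move=> gXY; apply/(can_inj (flatK g))/one_form_ext. Qed.

Lemma nabla_form_flat (g : metric M) (nb : levi_civita g) X W :
  nabla_form nb X (g W) = g (nb X W).
Proof.
by apply: one_form_ext => Y; rewrite /= (lc_metric nb) addrK.
Qed.

(** The difference of two such operators, lowered by [g], is symmetric in its
    first two arguments and skew in its last two, hence zero.  [D] is a bare
    operator, so that no connection has to be built from it. *)
Lemma levi_civita_unique (g : metric M) (nb : levi_civita g)
    (D : vf -> vf -> vf) :
    (forall X Y, D X Y - D Y X = bracket X Y) ->
    (forall X Y Z : vf, X (g Y Z) = g (D X Y) Z + g Y (D X Z)) ->
  forall X Y, nb X Y = D X Y.
Proof.
move=> Dtor Dmet.
pose d X Y := nb X Y - D X Y; pose t X Y Z : C := g (d X Y) Z.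
have tS X Y Z : t X Y Z = t Y X Z.
  rewrite /t; suff -> : d X Y = d Y X by [].
  rewrite /d -[nb X Y](subrK (nb Y X)) -[D X Y](subrK (D Y X)).
  by rewrite lc_torsion_free Dtor opprD addrACA subrr add0r.
have tA X Y Z : t X Y Z = - t X Z Y.
  rewrite /t [g (d X Z) Y]flatC /d !(metricDl, metricDr) metricNl.
  have := Dmet X Y Z; rewrite (lc_metric nb) metricNr => e.
  have -> : g (nb X Y) Z = g (D X Y) Z + g Y (D X Z) - g Y (nb X Z) :> C.
    by rewrite -e addrK.
  ring.
have t0 X Y Z : t X Y Z = 0.
  apply: smooth_double_eq0.
  have {1}-> : t X Y Z = - t X Y Z.
    by rewrite [LHS]tA (tS X Z) (tA Z X) opprK (tS Z Y) (tA Y Z) (tS Y X).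
  exact: addNr.
move=> X Y; apply/eqP; rewrite -subr_eq0; apply/eqP/(@metric_inj g) => Z.
by rewrite -[LHS]/(t X Y Z) t0 -(scale0r 0) metricZl mul0r.
Qed.

(** [g] only identifies 1-forms with vector fields here; [nb] may be the
    connection of another metric. *)
Lemma curvature_flat (g : metric M) (nb : connection M) (D : vf -> vf -> vf) :
    (forall X W, nabla_form nb X (g W) = g (D X W)) ->
  forall X Y W, curvature nb X Y (g W) =
    g (D X (D Y W) - D Y (D X W) - D (bracket X Y) W).
Proof. by move=> nbD X Y W; rewrite /curvature !nbD !flatB. Qed.

End Fields.

(** * The ring of vector fields *)

Section Product.
Variables (R : realType) (n : nat) (M : manifold R n) (S : F_data M).
Local Notation C := (smooth_fun M).
Local Notation vf := (vector_field M).
Local Notation cst := (smooth_cst M).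
Local Notation gt := (tmet S).
Local Notation E := (euler S).
Local Notation "X ** Y" := (dot S X Y) (at level 40, left associativity).

Lemma dotDl X Y Z : (X + Y) ** Z = X ** Z + Y ** Z.
Proof. by rewrite -[X]scale1r fmul_linearl !scale1r. Qed.

Lemma dotZl f X Y : (f *: X) ** Y = f *: (X ** Y).
Proof.
have d0 : 0 ** Y = 0 by apply: (addrI (0 ** Y)); rewrite -dotDl !addr0.
by rewrite -[f *: X]addr0 fmul_linearl d0 addr0.
Qed.

(** The alias carries the proof of the ring axioms, so that the ring structure,
    which vector fields do not have by themselves, is found by inference. *)
Definition tangent_ring of assoc_comm_unital S : Type := vf.

HB.instance Definition _ (h : assoc_comm_unital S) :=
  GRing.Zmodule.copy (tangent_ring h) vf.

Section Ring.
Hypothesis h : assoc_comm_unital S.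
Let dotA : associative (dot S). Proof. by case: h. Qed.
Let dotC : commutative (dot S). Proof. by case: h. Qed.
Let dot1 : left_id (unity S) (dot S). Proof. by case: h. Qed.

HB.instance Definition _ :=
  GRing.Zmodule_isComPzRing.Build (tangent_ring h) dotA dotC dot1 dotDl.
End Ring.

Lemma dot_form_flat X Y : dot_form S (gt X) (gt Y) = gt (X ** Y).
Proof. by rewrite /dot_form !flatK. Qed.

Variable tnb : levi_civita gt.

Lemma nabla_dot_form_flat X Y Z :
  nabla_dot_form tnb X (gt Y) (gt Z) = gt (nabla_dot tnb X Y Z).
Proof.
by rewrite /nabla_dot_form !(nabla_form_flat, dot_form_flat) !flatB.
Qed.

Lemma T_op_flat k D X :
  T_op tnb k D (gt X) = gt (cst ((D + k) / 2) *: X - tnb X E).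
Proof. by rewrite /T_op flatK flatB flatZ. Qed.

(** The symmetry gt (Y Z) V = gt (Y V) Z, differentiated along [X]. *)
Lemma nabla_dot4_swap34 : (forall X Y, X ** Y = Y ** X) -> dot_invariant S ->
  forall X Y Z V, nabla_dot4 tnb X Y Z V = nabla_dot4 tnb X Y V Z.
Proof.
move=> dotC inv X Y Z V.
have adj U W : gt (Y ** U) W = gt (Y ** W) U :> C.
  by rewrite dotC inv flatC.
have expand U W : nabla_dot4 tnb X Y U W =
    X (gt (Y ** U) W) - gt (Y ** U) (tnb X W) - gt (tnb X Y ** U) W
      - gt (Y ** tnb X U) W :> C.
  by rewrite (lc_metric tnb) addrK /nabla_dot4 /nabla_dot !metricDl !metricNl.
have adjN : gt (tnb X Y ** Z) V = gt (tnb X Y ** V) Z :> C.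
  by rewrite dotC inv flatC.
rewrite !expand (adj Z V) adjN (adj Z (tnb X V)) (adj (tnb X Z) V); ring.
Qed.
End Product.

(** The transpositions of 0 with j generate S_4, and each of them is a product
    of adjacent ones. *)
Lemma symmetric4_of_swaps (R : realType) (n : nat) (M : manifold R n)
    (t : vector_field M -> vector_field M -> vector_field M -> vector_field M ->
         smooth_fun M) :
  (forall X Y Z V, t X Y Z V = t Y X Z V) ->
  (forall X Y Z V, t X Y Z V = t X Z Y V) ->
  (forall X Y Z V, t X Y Z V = t X Y V Z) -> symmetric4 t.
Proof.
move=> t12 t23 t34 s.
pose invariant (s : 'S_4) := forall v : 'I_4 -> vector_field M,
  t (v (s ord0)) (v (s (inord 1))) (v (s (inord 2))) (v (s ord_max)) =
  t (v ord0) (v (inord 1)) (v (inord 2)) (v ord_max).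
rewrite -/(invariant s).
have /gen_prodgP[m [c cT ->]] : s \in <<[set tperm ord0 j | j in 'I_4]>>%g.
  by rewrite gen_tperm inE.
apply: (big_ind invariant) => [v|s1 s2 inv1 inv2 v|i _ v].
- by rewrite !perm1.
- by rewrite !permM (inv1 (v \o s2)) inv2.
have /imsetP[j _ ->] := cT i.
(* With literal ordinals the transpositions compute. *)
have -> : inord 1 = Ordinal (isT : (1 < 4)%N).
  by apply/val_inj; rewrite /= inordK.
have -> : inord 2 = Ordinal (isT : (2 < 4)%N).
  by apply/val_inj; rewrite /= inordK.
have -> : ord_max = Ordinal (isT : (3 < 4)%N) by apply/val_inj.
case: j => [[|[|[|[|//]]]] lt_j]; rewrite !permE /= (bool_irrelevance lt_j isT).
- by congr (t (v _) _ _ _); apply/val_inj.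
- exact: t12.
- by rewrite t12 t23 t12.
- by rewrite t12 t23 t34 t23 t12.
Qed.

Lemma symmetric4_swap12 (R : realType) (n : nat) (M : manifold R n)
    (t : vector_field M -> vector_field M -> vector_field M -> vector_field M ->
         smooth_fun M) :
  symmetric4 t -> forall X Y Z V, t X Y Z V = t Y X Z V.
Proof.
move=> sym X Y Z V.
have := sym (tperm ord0 (inord 1)) (fun i => nth X [:: Y; X; Z; V] i).
by rewrite /= tpermL tpermR !tpermD -?val_eqE /= ?inordK.
Qed.

(** * Weak F-manifolds *)

Section WeakF.
Variables (R : realType) (n : nat) (M : manifold R n) (S : F_data M).
Local Notation C := (smooth_fun M).
Local Notation vf := (vector_field M).
Local Notation cst := (smooth_cst M).
Local Notation gt := (tmet S).
Local Notation E := (euler S).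
Local Notation Einv := (euler_inv S).
Local Notation "X ** Y" := (dot S X Y) (at level 40, left associativity).
Variables (tnb : levi_civita gt) (k D : R).
Hypothesis axA : assoc_comm_unital S.
Hypothesis axE : euler_axioms tnb k D.
Hypothesis inv : dot_invariant S.
Hypothesis dot4E : forall X Y Z,
  nabla_dot4 tnb X Y Z E = nabla_dot4 tnb E X Y Z.

Local Notation A := (tangent_ring axA).
Let nab : A -> A -> A := tnb.
Let c : A := cst ((D + k) / 2) *: unity S.
Let kA : A := cst k *: unity S.

Let nabDl x y z : nab (x + y) z = nab x z + nab y z.
Proof. by have := nabla_linear tnb 1 x y z; rewrite !scale1r. Qed.

Let nabDr x y z : nab x (y + z) = nab x y + nab x z.
Proof. exact: nablaD. Qed.

Let EEinv : (E : A) * Einv = 1.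
Proof. by case: axE. Qed.

Lemma scale_unity (f : C) (x : A) : (f *: unity S : A) * x = f *: x :> vf.
Proof. by rewrite [LHS]dotZl [_ ** _](mul1r x). Qed.

Let lieM (x y : A) :
  nab_mul nab E x y - nab (x * y) E + nab x E * y + x * nab y E = kA * (x * y).
Proof.
case: axE => _ lie _ _.
have {}lie : (nab E (x * y) - nab (x * y) E) - (nab E x - nab x E) * y
    - x * (nab E y - nab y E) = kA * (x * y) :> A.
  by rewrite [RHS]scale_unity -[RHS]lie -!(lc_torsion_free tnb).
rewrite -lie /nab_mul; ring.
Qed.

(* The weak symmetry axiom, with the last two slots of nabla_dot4 exchanged so
   that nondegeneracy cancels the last one. *)
Let nab_mul_euler (x y : A) : nab_mul nab x E y = nab_mul nab E x y.
Proof.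
apply: (@metric_inj _ _ _ gt) => Z.
rewrite [nab_mul nab x E y]nab_mulC.
have := dot4E x y Z.
rewrite nabla_dot4_swap34 //; by case: axA.
Qed.

Let killing (x y : A) :
  gt (nab x E) y + gt x (nab y E) = gt ((c + c - kA) * x) y :> C.
Proof.
case: axE => _ _ + _ => /(_ x y).
have -> : (c + c - kA) * x = cst D *: x :> vf.
  rewrite -scale_unity; congr (_ * _ : A).
  rewrite /c /kA -scalerDl -smooth_cstD -splitr.
  by rewrite smooth_cstD scalerDl addrK.
rewrite metricZl => <-.
rewrite (lc_metric tnb) -!(lc_torsion_free tnb).
rewrite metricDr metricNr metricDl metricNl /nab; ring.
Qed.

Lemma T_op_twist X : T_op tnb k D (gt X) = gt (twist nab E c X).
Proof. by rewrite T_op_flat /twist scale_unity. Qed.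

Lemma nabla_T_twist X W :
  nabla_T tnb k D X (gt W) = gt (nab_twist nab E c X W).
Proof.
by rewrite /nabla_T T_op_twist !nabla_form_flat T_op_twist -flatB.
Qed.

Variables (g : metric M) (nb : levi_civita g).
Hypothesis gE : forall X, sharp g (gt X) = E ** X.

Lemma dual_flatE W : gt W = g (E ** W).
Proof. by rewrite -gE sharpK. Qed.

(** [dual_nab] is conjugated back to an operator on vector fields, to which
    uniqueness of the Levi-Civita connection of [g] applies; on multiples of
    [E], g (E z) (E v) = gt (E z) v. *)
Lemma nabla_form_dual X W :
  nabla_form nb X (gt W) = gt (dual_nab nab E Einv c X W).
Proof.
rewrite !dual_flatE nabla_form_flat; congr (g _).
pose D' (Y Z : A) : A := (E : A) * dual_nab nab E Einv c Y ((Einv : A) * Z).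
rewrite (@levi_civita_unique _ _ _ g nb D').
- by rewrite /D' (Einv_mulEl EEinv).
- move=> Y Z; rewrite -(lc_torsion_free tnb).
  rewrite -[Y](E_mulEinvl EEinv) -[Z](E_mulEinvl EEinv).
  rewrite /D' !(Einv_mulEl EEinv).
  rewrite -[LHS](mulrBr (E : A)).
  by rewrite (dual_torsion c EEinv lieM nab_mul_euler).
have gA (Z V : A) : g ((E : A) * Z) V = gt Z V :> C by rewrite -dual_flatE.
have adj (Z V : A) : gt Z ((E : A) * V) = gt ((E : A) * Z) V :> C.
  by rewrite [(E : A) * Z]mulrC -[LHS]inv.
move=> Y Z V; rewrite -[Z](E_mulEinvl EEinv) -[V](E_mulEinvl EEinv).
rewrite /D' !(Einv_mulEl EEinv).
move: ((Einv : A) * Z : A) ((Einv : A) * V : A) => z v.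
rewrite !gA !adj (lc_metric tnb).
have gDl := @metricDl _ _ _ gt; have gDr := @metricDr _ _ _ gt.
exact: (@dual_metric A nab E Einv c kA EEinv lieM nab_mul_euler C
  (fun x y => gt x y) gDl gDr inv killing).
Qed.

Lemma curvature_difference_flat (W X Y : A) :
  curvature nb (E ** X) (E ** Y) (gt W)
    - curvature tnb (E ** X) (E ** Y) (gt W) =
  gt (nabla_dot tnb (E ** X) (twist nab E c W ** Einv) (E ** Y)
      - nabla_dot tnb (E ** Y) (twist nab E c W ** Einv) (E ** X)
      + nab_twist nab E c (E ** X) W ** Y - nab_twist nab E c (E ** Y) W ** X).
Proof.
rewrite (curvature_flat nabla_form_dual) (curvature_flat (nabla_form_flat tnb)).
rewrite -flatB; congr (gt _).
pose b : A := Einv ** bracket (E ** X) (E ** Y).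
have bE : (E : A) * b = bracket (E ** X) (E ** Y) by exact: (E_mulEinvl EEinv).
rewrite -bE.
have bEnab : (E : A) * b =
    nab ((E : A) * X) ((E : A) * Y) - nab ((E : A) * Y) ((E : A) * X).
  by rewrite bE -(lc_torsion_free tnb).
exact: (dual_curvature nabDl nabDr c EEinv lieM nab_mul_euler W bEnab).
Qed.

Lemma curvature_difference a X Y :
  curvature nb (E ** X) (E ** Y) a - curvature tnb (E ** X) (E ** Y) a =
    nabla_dot_form tnb (E ** X) (dot_form S (T_op tnb k D a) (gt Einv))
                                (dot_form S (gt E) (gt Y))
    - nabla_dot_form tnb (E ** Y) (dot_form S (T_op tnb k D a) (gt Einv))
                                  (dot_form S (gt E) (gt X))
    + dot_form S (nabla_T tnb k D (E ** X) a) (gt Y)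
    - dot_form S (nabla_T tnb k D (E ** Y) a) (gt X).
Proof.
rewrite -[a](sharpK gt); move: (sharp gt a) => W.
rewrite curvature_difference_flat T_op_twist !nabla_T_twist.
by rewrite !dot_form_flat !nabla_dot_form_flat flatB flatD flatB.
Qed.

(** The symmetry in the last three arguments is automatic, so that exchanging
    the first argument with one of them suffices. *)
Lemma F_manifold_iff : F_manifold tnb k D <->
  forall U X Y, nabla_dot tnb X U Y = nabla_dot tnb Y U X.
Proof.
have dotC : forall X Y, X ** Y = Y ** X by case: axA.
have sw23 X Y Z : nabla_dot tnb X Y Z = nabla_dot tnb X Z Y.
  exact: (@nab_mulC A nab).
have sw34 := @nabla_dot4_swap34 _ _ _ S tnb dotC inv.
split=> [[_ _ _ sym] U X Y|sym].
  rewrite (sw23 X) (sw23 Y); apply: (@metric_inj _ _ _ gt) => Z.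
  exact: (symmetric4_swap12 sym).
split=> //; apply: symmetric4_of_swaps => X Y Z V //.
- by rewrite /nabla_dot4 sw23 sym sw23.
- by rewrite /nabla_dot4 sw23.
Qed.

(** By invertibility of T and [E], [U], [X] and [Y] are all reached by the
    arguments T(a) E^-1, E X' and E Y' of the curvature formula. *)
Lemma curvature_difference_iff :
   (forall U X Y, nabla_dot tnb X U Y = nabla_dot tnb Y U X) <->
   forall (a : one_form M) (X Y : vector_field M),
     curvature nb (E ** X) (E ** Y) a - curvature tnb (E ** X) (E ** Y) a =
     dot_form S (nabla_T tnb k D (E ** X) a) (gt Y)
       - dot_form S (nabla_T tnb k D (E ** Y) a) (gt X).
Proof.
split=> [sym a X Y|curv U X Y].
  rewrite curvature_difference -{1 2}[a](sharpK gt) T_op_twist.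
  by rewrite !dot_form_flat !nabla_dot_form_flat sym subrr add0r.
case: axE => _ _ _ [T' _ TK].
have UE : (U ** E) ** Einv = U.
  by rewrite -[LHS](mulrA (U : A)) EEinv [LHS](mulr1 (U : A)).
have := curv (T' (gt (U ** E))) (Einv ** X) (Einv ** Y).
rewrite curvature_difference TK !dot_form_flat UE.
rewrite ![E ** (Einv ** _)](E_mulEinvl EEinv) !nabla_dot_form_flat.
have cancel (x d : one_form M) : x + d = d -> x = 0.
  by move=> xd; apply: (addIr d); rewrite add0r.
by rewrite -addrA => /cancel/subr0_eq/(can_inj (flatK gt)).
Qed.

End WeakF.

Theorem theorem23 (R : realType) (n : nat) (M : manifold R n) (S : F_data M)
    (tnb : levi_civita (tmet S)) (k D : R)
    (g : metric M) (nb : levi_civita g) :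
  let gt := tmet S in
  let E := euler S in
  let T := T_op tnb k D in
  weak_F_manifold tnb k D ->
  (forall X : vector_field M, sharp g (gt X) = dot S E X) ->
  (forall (a : one_form M) (X Y : vector_field M),
     curvature nb (dot S E X) (dot S E Y) a
       - curvature tnb (dot S E X) (dot S E Y) a =
     nabla_dot_form tnb (dot S E X) (dot_form S (T a) (gt (euler_inv S)))
                                    (dot_form S (gt E) (gt Y))
       - nabla_dot_form tnb (dot S E Y) (dot_form S (T a) (gt (euler_inv S)))
                                        (dot_form S (gt E) (gt X))
       + dot_form S (nabla_T tnb k D (dot S E X) a) (gt Y)
       - dot_form S (nabla_T tnb k D (dot S E Y) a) (gt X)) /\
  (F_manifold tnb k D <->
   forall (a : one_form M) (X Y : vector_field M),
     curvature nb (dot S E X) (dot S E Y) a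
       - curvature tnb (dot S E X) (dot S E Y) a =
     dot_form S (nabla_T tnb k D (dot S E X) a) (gt Y)
       - dot_form S (nabla_T tnb k D (dot S E Y) a) (gt X)).
Proof.
move=> gt E T [axA axE inv dot4E] gE; split.
  exact: (curvature_difference axA axE inv dot4E nb gE).
rewrite (F_manifold_iff axA axE inv).
exact: (curvature_difference_iff axA axE inv dot4E nb gE).
Qed.
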